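(* Let $q=3$, let $n\ge 6$ be an integer, and let $t=\lceil\log_2 n\rceil$. Put $$k=\lfloor (n-3t+3)\log_2 3\rfloor+2(t-3).$$ Then for every integer $a$ with $0\le a\le n-1$ and every $b\in\mathbb{Z}_3$ there is a systematic encoder $E_{a,b}:\{0,1\}^k\to\mathcal{VT}_{a,b}(n)$ mapping $k$-bit messages to codewords of $\mathcal{VT}_{a,b}(n)$, and its rate satisfies $$\frac kn\ \ge\ \log_2 3-\frac{2.76\,\lceil\log_2 n\rceil}{n}-\frac{2.25}{n}.$$
   Context: $\mathbb{Z}_3=\{0,1,2\}$ is the ring of integers modulo $3$, with its elements ordered naturally $0<1<2$. For a sequence $S=s_0s_1\cdots s_{n-1}\in\mathbb{Z}_3^n$, the auxiliary binary sequence $A_S=\alpha_1\alpha_2\cdots\alpha_{n-1}$ of length $n-1$ is defined by $\alpha_i=1$ if $s_i\ge s_{i-1}$ and $\alpha_i=0$ if $s_i<s_{i-1}$, for $1\le i\le n-1$. Its VT syndrome is $\mathsf{syn}(A_S)=\sum_{i=1}^{n-1} i\,\alpha_i \bmod n$, an element of $\{0,\dots,n-1\}$. The modular sum is $\mathsf{sum}(S)=\sum_{i=0}^{n-1}s_i \bmod 3$. For $0\le a\le n-1$ and $b\in\mathbb{Z}_3$, the ternary Varshamov–Tenengolts code of length $n$ with parameters $(a,b)$ is $$\mathcal{VT}_{a,b}(n)=\{S\in\mathbb{Z}_3^n:\ \mathsf{syn}(A_S)=a,\ \mathsf{sum}(S)=b\}.$$ Systematic encoder: the message bits are assigned to pre-specified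 positions of the codeword. Precisely, for given $n$ there are a set of positions $P\subseteq\{0,\dots,n-1\}$ and an injective map $f:\{0,1\}^k\to\mathbb{Z}_3^P$, both independent of $a$, $b$ and the message, such that for all $a,b$ and all $M\in\{0,1\}^k$ the restriction of $E_{a,b}(M)$ to the positions in $P$ equals $f(M)$. (In particular each $E_{a,b}$ is injective.) *)

(* Defs.v *)
From mathcomp Require Import all_boot all_order all_algebra.
From mathcomp Require Import all_classical all_reals all_analysis.

Set Implicit Arguments.
Unset Strict Implicit.
Unset Printing Implicit Defensive.

Import Order.TTheory GRing.Theory Num.Theory.
Local Open Scope ring_scope.

Definition log2 {R : realType} (x : R) : R := ln x / ln 2.

(* Entry i (counted from 0) is alpha_(i+1); symbols of 'Z_3 are compared through
   their representatives 0 < 1 < 2 in nat. *)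
Definition aux_seq (n : nat) (S : n.-tuple 'Z_3) : n.-1.-tuple bool :=
  let s i : 'Z_3 := S`_i in [tuple (s i <= s i.+1)%N | i < n.-1].

Definition syn (n : nat) (A : n.-1.-tuple bool) : nat :=
  ((\sum_(i < n.-1) i.+1 * tnth A i) %% n)%N.

Definition modsum (n : nat) (S : n.-tuple 'Z_3) : 'Z_3 :=
  \sum_(i < n) tnth S i.

Definition VT (n a : nat) (b : 'Z_3) : {set n.-tuple 'Z_3} :=
  [set S | (syn (aux_seq S) == a) && (modsum S == b)].

Definition restr_word (n : nat) (P : {set 'I_n}) (S : n.-tuple 'Z_3) :
    {ffun {i : 'I_n | i \in P} -> 'Z_3} :=
  [ffun i => tnth S (val i)].

(* The positions P and the map f do not depend on a, b or the message. *)
Definition systematic_encoders (n k : nat)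
    (E : 'I_n -> 'Z_3 -> k.-tuple bool -> n.-tuple 'Z_3) : Prop :=
  (forall a b M, E a b M \in VT n a b) /\
  exists (P : {set 'I_n})
         (f : k.-tuple bool -> {ffun {i : 'I_n | i \in P} -> 'Z_3}),
    injective f /\ forall a b M, restr_word P (E a b M) = f M.

(* Main.v *)
(** Symbols 0 to 4 of the word, with symbol 5 set to 0, are reserved: they realise
    nine consecutive values of the weight [sum_(i <= 5) i alpha_i], each together
    with every residue of their sum. At each power [m = 2^j], [3 <= j < T], the
    symbol [s_m] is reserved too, and its neighbours are restricted to
    [x = s_(m-1) <> 0] and [s_(m+1) <> x - 1], that is to four pairs, worth two
    bits. Changing [s_m] from [x - 1] to [x] then raises the weight of the word by
    exactly [m], so the reserved symbols realise [2^T + 1] consecutive weights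
    together with every sum, which suffices as soon as [n <= 2^T + 1]. For
    [t = ceil (log2 n)] one takes [T = t], except when [n = 2^(t-1) + 1]: there the
    symbol at [2^(t-1)] has no right neighbour, and [T = t - 1] works, with even
    more room for the message. *)
Require Import Defs.
From mathcomp Require Import all_boot all_order all_algebra.
From mathcomp Require Import all_classical all_reals all_analysis.
From mathcomp Require Import zify ring lra.

Import Order.TTheory GRing.Theory Num.Theory.
Local Open Scope ring_scope.

(** * Weight and sum of a word, and control by its first symbols *)

Definition weight (n : nat) (s : nat -> 'Z_3) : nat :=
  (\sum_(0 <= i < n.-1) i.+1 * (s i <= s i.+1))%N.

Definition word_sum (n : nat) (s : nat -> 'Z_3) : 'Z_3 := \sum_(0 <= i < n) s i.

(** A finite search over the first five symbols. Pinning symbol 5 to 0 fixes the comparison at the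
    border, so the block can be glued to any word with a 0 there. *)
Lemma low_control (w : nat) (b : 'Z_3) : (w <= 8)%N ->
  exists s : nat -> 'Z_3, [/\ s 5 = 0, weight 6 s = (4 + w)%N & word_sum 5 s = b].
Proof.
pose z : seq 'Z_3 := [:: 0; 1; 2%:R].
pose s (x : seq 'Z_3) i := nth 0 x i.
have inz (y : 'Z_3) : y \in z.
  by case: y => [[|[|[|]]] //= ?]; rewrite !inE /eq_op.
pose good w b (x : seq 'Z_3) :=
  let c i := (s x i <= s x i.+1)%N : nat in
  ((1 * c 0 + 2 * c 1 + 3 * c 2 + 4 * c 3 + 5 * c 4 == 4 + w)%N) &&
  (s x 0 + s x 1 + s x 2 + s x 3 + s x 4 == b).
have H : all (fun w => all (fun b => has (fun x0 => has (fun x1 => has (fun x2 =>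
   has (fun x3 => has (fun x4 => good w b [:: x0; x1; x2; x3; x4]) z) z) z) z) z) z)
   (iota 0 9) by vm_compute.
move=> w8; have /(allP H)/allP/(_ _ (inz b)) : w \in iota 0 9 by rewrite mem_iota.
case/hasP=> x0 _ /hasP[x1 _] /hasP[x2 _] /hasP[x3 _] /hasP[x4 _] /andP[].
have : s [:: x0; x1; x2; x3; x4] 5 = 0 by [].
rewrite /good; move: (s _) => f f5 /eqP e1 /eqP e2; exists f; split; first by [].
  by rewrite -e1 /weight /= 5?[in LHS]big_nat_recr ?big_geq.
by rewrite -e2 /word_sum unlock /= addr0 !addrA.
Qed.

Lemma weight_split (n : nat) (s : nat -> 'Z_3) : (6 <= n)%N ->
  weight n s = (weight 6 s + \sum_(5 <= i < n.-1) i.+1 * (s i <= s i.+1))%N.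
Proof. by move=> n6; rewrite /weight (@big_cat_nat _ _ _ 5) //=; lia. Qed.

Lemma eq_weight (n : nat) (s s' : nat -> 'Z_3) : {in gtn n, s =1 s'} ->
  weight n s = weight n s'.
Proof.
move=> e; apply: eq_big_nat => i /andP[_ ilt].
by rewrite !e // /in_mem /=; lia.
Qed.

(** * Changing a single symbol *)

Definition upd (s : nat -> 'Z_3) (m : nat) (y : 'Z_3) (i : nat) : 'Z_3 :=
  if i == m then y else s i.

(* [x - 1] and [x] are on either side of the threshold [x] on the left, and on
   the same side of the threshold [y] on the right, as [y != x - 1]. *)
Lemma ascent_flip (x y : 'Z_3) : x != 0 -> y != x - 1 ->
  [/\ (x <= (x - 1)%R)%N = false & ((x - 1)%R <= y)%N = (x <= y)%N].
Proof.
have H : [forall x : 'Z_3, forall y : 'Z_3, (x != 0) ==> (y != x - 1) ==>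
  ((x <= (x - 1)%R)%N == false) && (((x - 1)%R <= y)%N == (x <= y)%N)].
  apply/forallP=> -[[|[|[|]]] // ?]; apply/forallP=> -[[|[|[|]]] // ?]; by vm_compute.
by move/forallP/(_ x)/forallP/(_ y)/implyP: H => H /H /implyP{}H /H /andP[/eqP-> /eqP->].
Qed.

(** Only the comparisons of [s m] with its two neighbours can change. By [ascent_flip] the left one,
    of weight [m], turns from descent to ascent, and the right one is unaffected. *)
Lemma weight_flip (n m : nat) (s : nat -> 'Z_3) :
  (0 < m)%N -> (m.+1 < n)%N -> s m.-1 != 0 -> s m.+1 != s m.-1 - 1 ->
  s m = s m.-1 - 1 ->
  weight n (upd s m (s m.-1)) = (weight n s + m)%N.
Proof.
case: m => // m _ mn /= x0 yx e; have [a1 a2] := ascent_flip _ _ x0 yx.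
rewrite /weight (@big_cat_nat _ _ _ m) //=; last by lia.
rewrite [in RHS](@big_cat_nat _ _ _ m) //=; last by lia.
rewrite !(@big_ltn _ _ _ m) ?(@big_ltn _ _ _ m.+1); try lia.
have eqs (a b : nat) : (b <= m \/ m.+2 <= a)%N ->
   (\sum_(a <= i < b) i.+1 * (upd s m.+1 (s m) i <= upd s m.+1 (s m) i.+1) =
   \sum_(a <= i < b) i.+1 * (s i <= s i.+1))%N.
  move=> h; apply: eq_big_nat => i ?; rewrite /upd.
  by case: eqP => [|_]; [lia|]; case: eqP => // ; lia.
rewrite !eqs; try lia.
have u1 : upd s m.+1 (s m) m = s m by rewrite /upd ltn_eqF.
have u2 : upd s m.+1 (s m) m.+1 = s m by rewrite /upd eqxx.
have u3 : upd s m.+1 (s m) m.+2 = s m.+2 by rewrite /upd gtn_eqF.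
by rewrite u1 u2 u3 e a1 a2 leqnn muln0 muln1; lia.
Qed.

Lemma word_sum_upd (n m : nat) (s : nat -> 'Z_3) (y : 'Z_3) : (m < n)%N ->
  word_sum n (upd s m y) = word_sum n s - s m + y.
Proof.
move=> mn; rewrite /word_sum !big_mkord (bigD1 (Ordinal mn)) //=.
rewrite [in RHS](bigD1 (Ordinal mn)) //= /upd eqxx.
set A := \sum_(i < n | _) _; set B := \sum_(i < n | _) _.
have -> : A = B by apply: eq_bigr => i; rewrite -val_eqE /= => /negbTE->.
by rewrite (addrC (s m)) addrK addrC.
Qed.

(** * Control symbols at powers of two *)

Definition centre (T i : nat) : bool :=
  has (fun j => i == (2 ^ j)%N) (index_iota 3 T).

Lemma centreP (T i : nat) :
  reflect (exists2 j, (3 <= j < T)%N & i = (2 ^ j)%N) (centre T i).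
Proof.
apply: (iffP hasP) => -[j]; first by rewrite mem_index_iota => ? /eqP ->; exists j.
by move=> ? ->; exists j => //; rewrite mem_index_iota.
Qed.

Lemma centreS (T i : nat) : (3 <= T)%N ->
  centre T.+1 i = centre T i || (i == (2 ^ T)%N).
Proof.
move=> T3; rewrite /centre /index_iota subSn // -[(T - 3).+1]addn1 iotaD has_cat.
by rewrite /= subnKC // orbF.
Qed.

Lemma centre_bounds (T i : nat) : (centre T i -> (8 <= i) && (2 * i <= 2 ^ T))%N.
Proof.
case/centreP=> j /andP[j3 jT] ->.
by rewrite -expnS !(@leq_pexp2l 2 3) // leq_pexp2l.
Qed.

(** Keeps distinct centres at least 8 apart, so that no position within distance 2 of a centre is
    another centre. *)
Lemma centre_dvd8 (T i : nat) : centre T i -> (8 %| i)%N.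
Proof. by case/centreP=> j /andP[j3 _] ->; rewrite (@dvdn_exp2l 2 3). Qed.

(* The bits [2^j], [3 <= j < T], reach all multiples of 8 below [2^T]; as the
   control symbols cover nine consecutive weights, [2^T] itself is reached. *)
Lemma weight_sum_reachable (T n : nat) (s : nat -> 'Z_3) :
  (3 <= T)%N -> (2 ^ T.-1 + 2 <= n)%N -> s 5 = 0 ->
  (forall m, centre T m -> (s m.-1 != 0) && (s m.+1 != s m.-1 - 1)) ->
  exists c, forall D b, (D <= 2 ^ T)%N -> exists s' : nat -> 'Z_3,
    [/\ forall i, (5 <= i)%N -> ~~ centre T i -> s' i = s i,
        weight n s' = (c + D)%N & word_sum n s' = b].
Proof.
elim: T s => [//|T IH] s; rewrite ltnS leq_eqVlt => /orP[/eqP<- n6 s5 _|T3 /= n_ge s5 sm].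
  have {}n6 : (6 <= n)%N := n6.
  (* The least weight given by [low_control], plus the fixed contribution of the symbols from 5
     on. *)
  exists (4 + \sum_(5 <= i < n.-1) i.+1 * (s i <= s i.+1))%N => D b D8.
  have [x [x5 x1 x2]] := low_control D (b - \sum_(5 <= i < n) s i) D8.
  exists (fun i => if (i < 5)%N then x i else s i); split.
  - by move=> i i5 _; rewrite ltnNge i5.
  - rewrite weight_split; last by lia.
    rewrite -[in RHS]addnA [in RHS](addnC _ D) addnA -x1; congr (_ + _)%N.
      apply: eq_weight => i; rewrite /in_mem /= => i6.
      case: ltnP => // i5; have -> : i = 5 by lia.
      by rewrite s5 x5.
    apply: eq_big_nat => i /andP[i5 _].
    by rewrite !(ltnNge _ 5) i5 (leq_trans i5).
  - rewrite /word_sum (@big_cat_nat _ _ _ 5) //=; last by lia.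
    have -> : \sum_(5 <= i < n) (if (i < 5)%N then x i else s i) = \sum_(5 <= i < n) s i.
      by apply: eq_big_nat => i /andP[i5 _]; rewrite (ltnNge _ 5) i5.
    have -> : \sum_(0 <= i < 5) (if (i < 5)%N then x i else s i) = word_sum 5 x.
      by apply: eq_big_nat => i /andP[_ ->].
    by rewrite x2 subrK.
have e8 : (8 <= 2 ^ T)%N by rewrite (@leq_pexp2l 2 3).
have eT : (2 ^ T = 2 * 2 ^ T.-1)%N by rewrite -expnS prednK //; lia.
set m := (2 ^ T)%N in e8 eT n_ge *.
have cm : centre T.+1 m by rewrite centreS // eqxx orbT.
have nc i : (m.-1 <= i)%N -> ~~ centre T i.
  by move=> mi; apply/negP=> /centre_bounds; rewrite -/m; lia.
(* The new centre starts in its low state. As [m] is not a centre for [T], the word from the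
   induction hypothesis keeps this value and can still be flipped. *)
pose s0 := upd s m (s m.-1 - 1).
have s0E i : i != m -> s0 i = s i by rewrite /s0 /upd => /negbTE->.
have [||||c Hc] := IH s0 => //; first by lia.
- by rewrite s0E //; lia.
- move=> p cp; have := centre_bounds _ _ cp; rewrite -/m => ?.
  by rewrite !s0E ?sm ?centreS ?cp //; lia.
exists c => D b; rewrite expnS -/m => DM.
have [Dm|mD] := leqP D m.
  have [s' [e1 e2 e3]] := Hc D b Dm.
  exists s'; split => // i i5; rewrite centreS // negb_or => /andP[ci im].
  by rewrite e1 // s0E.
(* The flip will add [m] to the weight and 1 to the sum, so both targets are lowered beforehand. *)
have [|s' [e1 e2 e3]] := Hc (D - m)%N (b - 1); first by lia.
have m1 : s' m.-1 = s m.-1 by rewrite e1 ?s0E ?nc //; lia.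
have m2 : s' m.+1 = s m.+1 by rewrite e1 ?s0E ?nc //; lia.
have m3 : s' m = s m.-1 - 1 by rewrite e1 ?nc // /s0 /upd ?eqxx //; lia.
have /andP[g1 g2] := sm _ cm.
exists (upd s' m (s' m.-1)); split.
- move=> i i5; rewrite centreS // negb_or => /andP[ci im].
  by rewrite /upd (negbTE im) e1 // s0E.
- rewrite weight_flip ?m1 ?m2 //; last by lia.
    by rewrite e2; lia.
  by lia.
- rewrite word_sum_upd; last by lia.
  by rewrite e3 m1 m3; ring.
Qed.

(** * Message digits and their placement around the control symbols *)

Definition alphabet (T i : nat) : nat :=
  if (i < 6)%N || centre T i then 1
  else if centre T i.+1 || centre T i.-1 then 2 else 3.

Lemma alphabet_bounds (T i : nat) : (0 < alphabet T i <= 3)%N.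
Proof. by rewrite /alphabet; case: ifP => // _; case: ifP. Qed.

(** Next to a centre the digits are 0 or 1: the left neighbour [x] is a digit plus 1, hence nonzero,
    and the right one is [x] plus a digit, hence never [x - 1 = x + 2]. *)
Definition message_word (T : nat) (d : nat -> 'Z_3) (i : nat) : 'Z_3 :=
  if (i < 6)%N then 0
  else if centre T i.+1 then d i + 1
  else if centre T i.-1 then d i.-2 + 1 + d i
  else d i.

Lemma centre_succ_pred (T m : nat) : centre T m ->
  [/\ centre T m.-1 = false, centre T m.-2 = false, centre T m.+1 = false
    & centre T m.+2 = false].
Proof.
move=> cm; have /andP[m8 _] := centre_bounds _ _ cm; have d8 := centre_dvd8 _ _ cm.
by split; apply/negbTE/negP => /centre_dvd8; lia.
Qed.

Lemma message_word_admissible (T : nat) (d : nat -> 'Z_3) :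
  (forall i, (d i < alphabet T i)%N) -> forall m, centre T m ->
  (message_word T d m.-1 != 0) && (message_word T d m.+1 != message_word T d m.-1 - 1).
Proof.
move=> dlt m cm; have /andP[m8 _] := centre_bounds _ _ cm.
have [c1 c2 c3 c4] := centre_succ_pred _ _ cm.
have mK : m.-1.+1 = m by lia.
have m6 : (m.-1 < 6)%N = false by lia.
have m6' : (m.+1 < 6)%N = false by lia.
rewrite /message_word m6 m6' /= mK cm c4.
have := dlt m.-1; have := dlt m.+1.
rewrite /alphabet m6 m6' /= mK cm c1 c3 c4 /=.
rewrite addrK.
by case: (d m.-1) (d m.+1) => [[|[|[|]]] // ?] [[|[|[|]]] // ?].
Qed.

(** Control digits are all 0. A right neighbour is decoded after the left neighbour two places
    before it. *)
Lemma message_word_inj (T n : nat) (d d' : nat -> 'Z_3) :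
  (forall i, (d i < alphabet T i)%N) -> (forall i, (d' i < alphabet T i)%N) ->
  (forall i, (6 <= i < n)%N -> ~~ centre T i ->
     message_word T d i = message_word T d' i) ->
  forall i, (i < n)%N -> d i = d' i.
Proof.
move=> dlt dlt' e i ilt.
have [i6|] := boolP ((i < 6)%N || centre T i).
  have := dlt' i; have := dlt i; rewrite /alphabet i6.
  by rewrite !ltnS !leqn0 => /eqP h /eqP h'; apply: val_inj; rewrite /= h h'.
rewrite negb_or -leqNgt => /andP[i6 ci].
have := e i; rewrite i6 ilt /message_word ltnNge i6 /= => /(_ isT ci).
have [_ /addIr //|ci1] := boolP (centre T i.+1).
have [cp|//] := boolP (centre T i.-1).
have /andP[m8 _] := centre_bounds _ _ cp.
have [c1 c2 c3 c4] := centre_succ_pred _ _ cp.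
have := e i.-2; rewrite /message_word (_ : (i.-2 < 6)%N = false); last by lia.
rewrite (_ : i.-2.+1 = i.-1) ?cp; last by lia.
move=> /(_ _ (negbT c1)) => h; have /addIr -> : d i.-2 + 1 = d' i.-2 + 1 by apply: h; lia.
by move=> /addrI.
Qed.

(** Each centre with its two neighbours contributes 1 * 2 * 2 = 4 instead of 27; the lower bound on
    [n] keeps the last right neighbour inside the word. *)
Lemma prod_alphabet (T n : nat) : (3 <= T)%N -> (2 ^ T.-1 + 2 <= n)%N ->
  (\prod_(i < n) alphabet T i * 27 ^ (T - 3) = 3 ^ (n - 6) * 4 ^ (T - 3))%N.
Proof.
elim: T => [//|T IH]; rewrite ltnS leq_eqVlt => /orP[/eqP<- n6|T3 /= n_ge].
  have {}n6 : (6 <= n)%N := n6.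
  rewrite subnn !muln1 -(big_mkord xpredT (alphabet 3)) (@big_cat_nat _ _ _ 6) //=.
  rewrite (@eq_big_nat _ _ _ 0 6 _ (fun=> 1%N)); last first.
    by move=> i /andP[_ h]; rewrite /alphabet h.
  rewrite (@eq_big_nat _ _ _ 6 n _ (fun=> 3%N)); last first.
    by move=> i /andP[h _]; rewrite /alphabet ltnNge h.
  by rewrite !prod_nat_const_nat exp1n mul1n.
have e8 : (8 <= 2 ^ T)%N by rewrite (@leq_pexp2l 2 3).
have eT : (2 ^ T = 2 * 2 ^ T.-1)%N by rewrite -expnS prednK //; lia.
have {}IH := IH T3.
have cS i := centreS T i T3.
have nc i : (2 ^ T - 2 <= i)%N -> centre T i = false.
  by move=> mi; apply/negbTE/negP=> /centre_bounds; lia.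
set m := (2 ^ T)%N in e8 eT n_ge cS nc *.
(* Passing from [T] to [T.+1] changes only these three factors. *)
have pE (F : nat -> nat) : (\prod_(i < n) F i = F m.-1 * (F m * (F m.+1 *
   \prod_(i < n | [&& (i != m.-1 :> nat), (i != m :> nat) & (i != m.+1 :> nat)]) F i)))%N.
  have h1 : (m.-1 < n)%N by lia.
  have h2 : (m < n)%N by lia.
  have h3 : (m.+1 < n)%N by lia.
  rewrite (bigD1 (Ordinal h1)) //= (bigD1 (Ordinal h2)) /=; last first.
    by rewrite -val_eqE /=; lia.
  rewrite (bigD1 (Ordinal h3)) /=; last by rewrite -!val_eqE /=; lia.
  by do 3 congr (_ * _)%N; apply: eq_bigl => i; rewrite -!val_eqE /= andbA.
rewrite pE subSn // !expnS.
have /IH : (2 ^ T.-1 + 2 <= n)%N by lia.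
rewrite pE.
have a (T' i : nat) : (6 <= i)%N -> alphabet T' i =
  if centre T' i then 1%N else if centre T' i.+1 || centre T' i.-1 then 2%N else 3%N.
  by move=> i6; rewrite /alphabet ltnNge i6.
have mK : m.-1.+1 = m by lia.
rewrite !a; try lia.
rewrite !cS !nc; try lia.
rewrite mK /= !eqxx orbT /=.
rewrite (_ : (m.-1 == m) = false); last by lia.
rewrite (_ : (m.+1 == m) = false); last by lia.
rewrite /=.
pose other (i : 'I_n) := [&& (i != m.-1 :> nat), (i != m :> nat) & (i != m.+1 :> nat)].
have -> : (\prod_(i < n | other i) alphabet T.+1 i = \prod_(i < n | other i) alphabet T i)%N.
  apply: eq_bigr => i /and3P[i1 i2 i3]; rewrite /alphabet !cS.
  have -> : (i == m :> nat) = false by lia.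
  have -> : (i.+1 == m) = false by lia.
  by have -> : (i.-1 == m) = false; [lia | rewrite !orbF].
by move=> h; rewrite [RHS]mulnCA -h; ring.
Qed.

(** * Counting digit families and assembling the encoder *)

Lemma card_bounded_family (n : nat) (w : nat -> nat) : (forall i, (w i <= 3)%N) ->
  #|family (fun i : 'I_n => [pred x : 'Z_3 | (x < w i)%N])| = (\prod_(i < n) w i)%N.
Proof.
move=> w3; rewrite card_family -[RHS]big_enum /= /image_mem.
elim: (enum _) => [|i s IH]; rewrite ?big_nil // big_cons /= IH; congr (_ * _)%N.
have := w3 i; rewrite -sum1_card big_mkcond /=.
by case: (w i) => [|[|[|[|]]]] // _; rewrite !big_ord_recr big_ord0.
Qed.

Lemma syn_mktuple (n : nat) (s : nat -> 'Z_3) :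
  syn (aux_seq [tuple s i | i < n]) = (weight n s %% n)%N.
Proof.
rewrite /syn /weight big_mkord; congr (_ %% _)%N; apply: eq_bigr => i _.
rewrite tnth_mktuple; have i_n := ltn_ord i.
have nthE j (jn : (j < n)%N) : [tuple s i | i < n]`_j = s j.
  by rewrite -(tnth_nth 0 _ (Ordinal jn)) tnth_mktuple.
by rewrite !nthE //; lia.
Qed.

Lemma modsum_mktuple (n : nat) (s : nat -> 'Z_3) :
  modsum [tuple s i | i < n] = word_sum n s.
Proof.
by rewrite /modsum /word_sum big_mkord; apply: eq_bigr => i _; rewrite tnth_mktuple.
Qed.

Lemma systematic_encoders_exist (n T k : nat) : (3 <= T)%N ->
  (2 ^ T.-1 + 2 <= n <= 2 ^ T + 1)%N ->
  (2 ^ k * 27 ^ (T - 3) <= 3 ^ (n - 6) * 4 ^ (T - 3))%N ->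
  exists E : 'I_n -> 'Z_3 -> k.-tuple bool -> n.-tuple 'Z_3,
    systematic_encoders E.
Proof.
move=> T3 /andP[n_ge n_le] cap.
pose F (i : 'I_n) : pred 'Z_3 := [pred x : 'Z_3 | (x < alphabet T i)%N].
have cardF : (#|{: k.-tuple bool}| <= #|family F|)%N.
  rewrite card_tuple card_bool card_bounded_family; last first.
    by move=> i; have /andP[] := alphabet_bounds T i.
  by rewrite -(@leq_pmul2r (27 ^ (T - 3))%N); [rewrite prod_alphabet | rewrite expn_gt0].
(* Messages are sent to digit families by rank, which is injective since there are enough
   families. *)
pose dat (M : k.-tuple bool) : {ffun 'I_n -> 'Z_3} :=
  enum_val (widen_ord cardF (enum_rank M)).
have dat_inj : injective dat.
  by move=> M M' /enum_val_inj/(congr1 val)/= h; apply/enum_rank_inj/val_inj.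
pose d M i : 'Z_3 := if insub i is Some j then dat M j else 0.
have dE M (i : 'I_n) : d M i = dat M i by rewrite /d valK.
have dlt M i : (d M i < alphabet T i)%N.
  rewrite /d; case: insubP => [j _ <-|_].
    by have /familyP/(_ j) := enum_valP (widen_ord cardF (enum_rank M)).
  by have /andP[] := alphabet_bounds T i.
pose P := [set i : 'I_n | (6 <= i)%N && ~~ centre T i].
pose f M : {ffun {i : 'I_n | i \in P} -> 'Z_3} :=
  [ffun i => message_word T (d M) (val (val i))].
have n_gt0 : (0 < n)%N by lia.
have codeword (x : 'I_n * 'Z_3 * k.-tuple bool) : exists S,
    S \in VT n x.1.1 x.1.2 /\ restr_word P S = f x.2.
  case: x => -[a b] M /=.
  have [c Hc] := weight_sum_reachable T n (message_word T (d M)) T3 n_ge erefl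
                   (message_word_admissible _ _ (dlt M)).
  have a_n := ltn_ord a; have c_n := ltn_pmod c n_gt0.
  (* This is [a - c] modulo [n]; being at most [n - 1], it is within the reachable range up to
     [2 ^ T]. *)
  have [|s [s1 s2 s3]] := Hc ((a + (n - c %% n)) %% n)%N b.
    by have := ltn_pmod (a + (n - c %% n)) n_gt0; lia.
  exists [tuple s i | i < n]; split.
    rewrite inE syn_mktuple modsum_mktuple s2 s3 eqxx andbT.
    rewrite modnDmr -modnDml addnCA subnKC; last exact: ltnW.
    by rewrite modnDr modn_small.
  apply/ffunP=> i; rewrite !ffunE tnth_mktuple.
  have := valP i; rewrite inE => /andP[i6 ci].
  by rewrite s1 // ltnW.
have [E HE] := choice codeword.
exists (fun a b M => E (a, b, M)); split; first by move=> a b M; have [] := HE (a, b, M).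
exists P, f; split; last by move=> a b M; have [] := HE (a, b, M).
move=> M M' /ffunP e; apply: dat_inj; apply/ffunP => i; rewrite -!dE.
apply: (@message_word_inj T n) => // j /andP[j6 jn] cj.
have jP : Ordinal jn \in P by rewrite inE j6.
by have := e (exist _ (Ordinal jn) jP); rewrite !ffunE.
Qed.

(** * Logarithm estimates, capacity and rate *)

Lemma ler_mul_log2_nat (R : realType) (a m j : nat) : (0 < a)%N ->
  (m%:R * log2 (a%:R : R) <= j%:R) = (a ^ m <= 2 ^ j)%N.
Proof.
move=> a0; have ln2 : 0 < ln (2 : R) by rewrite ln_gt0 // ltr1n.
rewrite /log2 mulrA ler_pdivrMr // !mulr_natl -!lnXn ?ltr0n //.
by rewrite ler_ln ?posrE ?exprn_gt0 ?ltr0n // -!natrX ler_nat.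
Qed.

Lemma ler_nat_mul_log2 (R : realType) (a m j : nat) : (0 < a)%N ->
  (j%:R <= m%:R * log2 (a%:R : R)) = (2 ^ j <= a ^ m)%N.
Proof.
move=> a0; have ln2 : 0 < ln (2 : R) by rewrite ln_gt0 // ltr1n.
rewrite /log2 mulrA ler_pdivlMr // !mulr_natl -!lnXn ?ltr0n //.
by rewrite ler_ln ?posrE ?exprn_gt0 ?ltr0n // -!natrX ler_nat.
Qed.

Lemma ceil_log2 (R : realType) (n : nat) : (1 < n)%N ->
  Num.ceil (log2 (n%:R : R)) = up_log 2 n.
Proof.
move=> n1; apply: ceil_def; have n0 := ltnW n1.
have := up_log_bounds (isT : 1 < 2)%N n1 => /= /andP[lo hi].
have t0 : (0 < up_log 2 n)%N by rewrite up_log_gt0.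
have h j : (log2 (n%:R : R) <= j%:R) = (n <= 2 ^ j)%N.
  by have := ler_mul_log2_nat R n 1 j n0; rewrite mul1r expn1.
have -> : (up_log 2 n : int) - 1 = (up_log 2 n).-1 by lia.
by rewrite -!pmulrn ltNge !h hi -ltnNge lo.
Qed.

(** These amount to [2 ^ 19 <= 3 ^ 12] and [3 ^ 29 <= 2 ^ 46], and are sharp enough for the
    constants 2.25 and 2.76. *)
Lemma log2_3_bounds (R : realType) : 19 <= 12 * log2 (3 : R) /\ 29 * log2 (3 : R) <= 46.
Proof.
split; first by rewrite (ler_nat_mul_log2 R 3 12 19 isT); lia.
by rewrite (ler_mul_log2_nat R 3 29 46 isT); lia.
Qed.

Lemma up_log2_bounds (n : nat) : (6 <= n)%N ->
  (3 <= up_log 2 n)%N /\ (3 * up_log 2 n <= n + 3)%N.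
Proof.
move=> n6; have /andP[] := up_log_bounds (isT : 1 < 2)%N (leq_trans (isT : 1 < 6)%N n6).
have growth j : (3 * j.+4 <= 2 ^ j.+3 + 4)%N.
  by elim: j => [|j IH]; rewrite // expnS; lia.
case: (up_log 2 n) => [|[|[|[|t]]]] /= lo hi; try by move: lo hi; lia.
by have := growth t; lia.
Qed.

Lemma rate_capacity (n t F : nat) : (6 <= n)%N -> (3 <= t)%N -> (3 * t <= n + 3)%N ->
  (2 ^ t.-1 < n <= 2 ^ t)%N -> (2 ^ F <= 3 ^ (n + 3 - 3 * t))%N ->
  exists T, [/\ (3 <= T)%N, (2 ^ T.-1 + 2 <= n <= 2 ^ T + 1)%N &
    (2 ^ (F + 2 * (t - 3)) * 27 ^ (T - 3) <= 3 ^ (n - 6) * 4 ^ (T - 3))%N].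
Proof.
move=> n6 t3 tn /andP[lo hi] cap; rewrite expnD expnM.
have [e|ne] := eqVneq n (2 ^ t.-1 + 1)%N; last first.
  exists t; split=> //; first by lia.
  have -> : (n - 6 = (n + 3 - 3 * t) + 3 * (t - 3))%N by lia.
  by rewrite expnD expnM mulnAC leq_mul2r leq_mul2r cap !orbT.
have t4 : (3 < t)%N.
  rewrite ltn_neqAle t3 andbT; apply/eqP=> t_3.
  by move: e n6; rewrite -t_3 => ->.
(* With one centre fewer, a factor 27 is available where the two bits of that centre require only
   4. *)
exists t.-1; split; first by lia.
  have et : (2 ^ t.-1 = 2 * 2 ^ t.-2)%N by rewrite -expnS prednK //; lia.
  have : (2 ^ 2 <= 2 ^ t.-2)%N by rewrite leq_exp2l //; lia.
  by rewrite e et; lia.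
have -> : (n - 6 = (n + 3 - 3 * t) + (3 + 3 * (t.-1 - 3)))%N by lia.
have -> : (t - 3 = (t.-1 - 3).+1)%N by lia.
rewrite (expnD 3 (n + 3 - 3 * t)) (expnD 3 3) (expnM 3 3) expnS.
rewrite (_ : (_ * _ * _ = 2 ^ F * (4 * (27 ^ (t.-1 - 3) * 4 ^ (t.-1 - 3))))%N);
  last by rewrite -[(2 ^ 2)%N]/4%N; ring.
by rewrite -!mulnA leq_mul // !mulnA leq_mul // leq_mul.
Qed.

Theorem mainTheorem4 (R : realType) (n : nat) (hn : (6 <= n)%N) :
  let t : int := Num.ceil (log2 (n%:R : R)) in
  exists k : nat,
    [/\ k%:Z = Num.floor ((n%:Z - 3 * t + 3)%:~R * log2 (3 : R)) + 2 * (t - 3),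
        exists E : 'I_n -> 'Z_3 -> k.-tuple bool -> n.-tuple 'Z_3,
          systematic_encoders E
      & k%:R / n%:R >= log2 (3 : R) - (276 / 100) * t%:~R / n%:R
                         - (225 / 100) / n%:R].
Proof.
have n1 : (1 < n)%N by lia.
rewrite ceil_log2 //=; have [t3 tn] := up_log2_bounds n hn.
have t_n := up_log_bounds (isT : 1 < 2)%N n1; rewrite /= in t_n.
set t := up_log 2 n in t3 tn t_n *.
pose N := (n + 3 - 3 * t)%N.
have -> : n%:Z - 3 * t%:Z + 3 = N by rewrite /N; lia.
set x : R := N%:~R * _; have xE : x = N%:R * log2 (3 : R) by rewrite /x -pmulrn.
have [l1 l2] := log2_3_bounds R.
have : 0 <= Num.floor x by rewrite floor_ge_int xE mulr_ge0 //; lra.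
case Fx : (Num.floor x) => [F|//] _.
have cap : (2 ^ F <= 3 ^ N)%N.
  by rewrite -(ler_nat_mul_log2 R) // -xE [F%:R]pmulrn -floor_ge_int Fx.
have [T [T3 nT capT]] := rate_capacity n t F hn t3 tn t_n cap.
exists (F + 2 * (t - 3))%N; split; first by lia.
  exact: systematic_encoders_exist T3 nT capT.
have F_gt : x < F%:R + 1 by have := floorD1_gt x; rewrite Fx intrD -pmulrn.
have NE : (N%:R : R) = n%:R + 3 - 3 * t%:R by rewrite /N natrB // natrD natrM.
have kE : ((F + 2 * (t - 3))%N%:R : R) = F%:R + 2 * (t%:R - 3).
  by rewrite natrD natrM natrB.
have n0 : 0 < (n%:R : R) by rewrite ltr0n; lia.
rewrite -pmulrn ler_pdivlMr // !mulrBl !divfK ?gt_eqF // kE.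
have t0 : 0 <= (t%:R : R) by [].
(* With L = log2 3, the message length exceeds n L - (3 L - 2) t + 3 L - 7. The bounds on L give 3 L
   - 2 <= 2.76 and 3 L - 7 >= -2.25. *)
move: F_gt; rewrite xE NE; nra.
Qed.
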